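(* Let $X=\{X_t\}_{t\ge0}$ be a finite reversible Markov chain with $n$ states, and let $x$ and $y$ be any two states. Then, for all integers $t\ge 4n+4$, $$\mathbf{P}_x(\tau(y)=t)\le\frac{\sqrt{2n}}{t},\qquad\text{whence}\qquad\mathbf{P}_x(\mathcal{S}_t)\le\frac{n\sqrt{2n}}{t}.$$
   Context: Markov chains are in discrete time and time-homogeneous, with state space $S$ and transition probabilities $p(\cdot,\cdot)$. Reversible means that there is a probability distribution $\pi$ on $S$ with $\pi(a)>0$ for all $a\in S$ and $\pi(a)p(a,b)=\pi(b)p(b,a)$ for all $a,b\in S$. $\mathbf{P}_x$ denotes the probability for the chain started at $X_0=x$. The hitting time is $\tau(y)=\min\{t\ge 0: X_t=y\}$ ($\infty$ if $y$ is never reached). $\mathcal{S}_t=\bigcup_{y\in S}\{\tau(y)=t\}$ is the event that the state visited at time $t$ was not visited at any earlier time. *)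

(* Defs.v *)
From HB Require Import structures.
From mathcomp Require Import all_boot all_order all_algebra.
From mathcomp Require Import all_classical all_reals all_analysis.

Set Implicit Arguments.
Unset Strict Implicit.
Unset Printing Implicit Defensive.

Import Order.TTheory GRing.Theory Num.Theory.

Local Open Scope classical_set_scope.
Local Open Scope ring_scope.

Definition stochastic (R : realType) (S : finType) (p : S -> S -> R) : Prop :=
  (forall a b, 0 <= p a b) /\ (forall a, \sum_(b : S) p a b = 1).

Definition reversible (R : realType) (S : finType) (p : S -> S -> R) : Prop :=
  exists pi : S -> R,
    [/\ \sum_(a : S) pi a = 1,
        forall a, 0 < pi a &
        forall a b, pi a * p a b = pi b * p b a].

(* Only meaningful when [P A != 0]: otherwise the value is [0]. *)
Definition cond_prob d (T : measurableType d) (R : realType)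
    (P : probability T R) (B A : set T) : R :=
  fine (P (B `&` A)) / fine (P A).

(* [{X_0 = a 0, ..., X_t = a t}]; the values of [a] beyond [t] are irrelevant. *)
Definition history (T S : Type) (X : nat -> T -> S) (a : nat -> S) (t : nat) :
  set T := [set w | forall s, (s <= t)%N -> X s w = a s].

(* [S] carries the discrete sigma-algebra, so that measurability of [X t] amounts
   to measurability of the events [{X_t = a}]. *)
Definition markov_chain_from d (T : measurableType d) (R : realType)
    (S : finType) (p : S -> S -> R) (x : S)
    (P : probability T R) (X : nat -> T -> S) : Prop :=
  [/\ stochastic p,
      forall t a, measurable (X t @^-1` [set a]),
      P (X 0 @^-1` [set x]) = 1%E &
      forall t (a : nat -> S) (b : S), P (history X a t) != 0%E ->
        cond_prob P (X t.+1 @^-1` [set b]) (history X a t) = p (a t) b].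

(* [None] stands for the value infinity. *)
Definition hitting_time (T : Type) (S : finType) (X : nat -> T -> S) (y : S)
    (w : T) : option nat :=
  match pselect (exists t, X t w == y) with
  | left h => Some (ex_minn h)
  | right _ => None
  end.

Definition new_state_at (T : Type) (S : finType) (X : nat -> T -> S) (t : nat) :
  set T := \bigcup_(y in [set: S]) [set w | hitting_time X y w = Some t].

(* Main.v *)
(* Write t - 1 = 2 m or 2 m + 1.  Killing the chain at y and grouping its steps
   two by two, P_x(tau(y) = t) becomes the probability that a chain with kernel
   M = Q ^ 2 is killed at time m + 1, where M is similar to a positive
   semidefinite symmetric matrix.  Cut the trajectory at its last visit to x,
   then at the last visit to the next state, and so on (loop erasure).  By the
   spectral theorem, the generating function of the loops at a state is a
   nonnegative combination of the 1 / (1 - l z) with 0 <= l < 1 (after scaling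
   M by rho < 1), so the killing time is a mixture of sums of k <= n independent
   geometric times.  It remains to bound the mass at T = m + 1 of such a sum.
   Replacing the rates one by one by a common rate only increases the largest
   possible value, and for equal rates the mass is a binomial probability,
   bounded through AM-GM and the central binomial coefficient by
   sqrt(k / 2) / T as soon as T >= 2 k. *)

Require Import Defs.
From mathcomp Require Import all_boot all_order all_algebra.
From mathcomp Require Import all_classical all_reals all_analysis.
From mathcomp Require Import ring zify.
From mathcomp Require complex.

Set Implicit Arguments.
Unset Strict Implicit.
Unset Printing Implicit Defensive.

Import Order.TTheory GRing.Theory Num.Theory.
Import numFieldNormedType.Exports.

Local Open Scope classical_set_scope.
Local Open Scope ring_scope.

(** * Sums of independent geometric times *)

(* Convolution with [0, 1, l, l^2, ...], i.e. the product of the generating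
   function of [f] with [z / (1 - l z)]. *)
Fixpoint geom_step (R : pzRingType) (l : R) (f : nat -> R) (T : nat) : R :=
  if T is T'.+1 then l * geom_step l f T' + f T' else 0.

Definition geom_conv (R : pzRingType) (L : seq R) : nat -> R :=
  foldr (@geom_step R) (fun T => (T == 0)%:R) L.

Section GeomConv.
Variable R : comPzRingType.
Implicit Types (L : seq R) (T : nat) (f g : nat -> R).

Lemma geom_stepS l f T : geom_step l f T.+1 = l * geom_step l f T + f T.
Proof. by []. Qed.

Lemma eq_geom_step l f g : f =1 g -> geom_step l f =1 geom_step l g.
Proof. by move=> fg; elim=> //= T ->; rewrite fg. Qed.

Lemma geom_step_sum l (I : Type) (r : seq I) (c : I -> R) (f : I -> nat -> R) T :
  geom_step l (fun T => \sum_(i <- r) c i * f i T) T =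
  \sum_(i <- r) c i * geom_step l (f i) T.
Proof.
elim: T => [|T IH]; first by rewrite /= big1 // => i _; rewrite mulr0.
by rewrite geom_stepS IH mulr_sumr -big_split; apply: eq_bigr => i _ /=; ring.
Qed.

Lemma geom_stepE l f T :
  geom_step l f T.+1 = \sum_(s < T.+1) l ^+ (T - s) * f s.
Proof.
elim: T => [|T IH]; first by rewrite big_ord1 /= mulr0 add0r mul1r.
rewrite geom_stepS IH [in RHS]big_ord_recr /= subnn mul1r mulr_sumr; congr (_ + _).
by apply: eq_bigr => s _; rewrite mulrA -exprS subSn // -ltnS.
Qed.

(** Both sides satisfy the recurrence [rec2], whose coefficients [a + b] and [a * b] are symmetric,
    and they agree at times 0 and 1. *)
Lemma geom_step_comm a b f :
  geom_step a (geom_step b f) =1 geom_step b (geom_step a f).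
Proof.
have rec2 c d T : geom_step c (geom_step d f) T.+2 =
    (c + d) * geom_step c (geom_step d f) T.+1
    - c * d * geom_step c (geom_step d f) T + f T.
  by rewrite !geom_stepS; ring.
move=> T; suff [] : geom_step a (geom_step b f) T = geom_step b (geom_step a f) T
    /\ geom_step a (geom_step b f) T.+1 = geom_step b (geom_step a f) T.+1 by [].
elim: T => [|T [IH IHS]]; first by rewrite /= !mulr0.
by split=> //; rewrite !rec2 IH IHS; ring.
Qed.

Lemma geom_conv_middle (a : R) L1 L2 :
  geom_conv (L1 ++ a :: L2) =1 geom_conv (a :: L1 ++ L2).
Proof.
elim: L1 => [//|b L1 IH] T.
by rewrite /= [LHS](eq_geom_step _ IH) geom_step_comm.
Qed.

Lemma geom_conv_perm L1 L2 : perm_eq L1 L2 -> geom_conv L1 =1 geom_conv L2.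
Proof.
elim: L1 L2 => [|a L1 IH] L2; first by rewrite perm_sym => /perm_nilP ->.
move=> eqL; have aL2 : a \in L2 by rewrite -(perm_mem eqL) mem_head.
case/splitPr: aL2 eqL => p q eqL T.
rewrite geom_conv_middle; apply: eq_geom_step => {}T; apply: IH.
by move: eqL; rewrite -[a :: q]cat1s perm_sym perm_catCA /= perm_cons perm_sym.
Qed.

(** Partial fractions: with generating functions [G_a(X) = X / (1 - a X)], one has
    [(z - l) G_z G_l = G_z - G_l]. *)
Lemma geom_conv_diff (z l : R) L T : (z - l) * geom_conv (z :: l :: L) T =
  geom_conv (z :: L) T - geom_conv (l :: L) T.
Proof.
have comm := geom_step_comm z l (geom_conv L).
have := comm T.+1; rewrite !geom_stepS -comm => e.
rewrite mulrBl; apply/eqP; rewrite subr_eq addrAC eq_sym subr_eq.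
by rewrite addrC -e.
Qed.

(** The negative binomial law up to its normalising factor; the recurrence of [geom_step] becomes
    Pascal's rule. *)
Lemma geom_conv_nseq k (z : R) T :
  geom_conv (nseq k.+1 z) T.+1 = 'C(T, k)%:R * z ^+ (T - k).
Proof.
elim: T k => [|T IH] [|k].
- by rewrite /= mulr0 add0r mulr1.
- by rewrite /= mulr0 add0r mul0r.
- rewrite [LHS]geom_stepS -[X in z * X]/(geom_conv (nseq 1 z) T.+1) IH !bin0 /= !mul1r.
  by rewrite !subn0 exprS addr0.
rewrite [LHS]geom_stepS -[X in z * X + _]/(geom_conv (nseq k.+2 z) T.+1) IH.
rewrite -[X in _ + X]/(geom_conv (nseq k.+1 z) T.+1) IH subSS binS natrD mulrDl.
congr (_ + _); case: (ltnP k T) => ltkT.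
  by rewrite mulrCA -exprS subnSK.
by rewrite bin_small // !mul0r mulr0.
Qed.

End GeomConv.

Lemma geom_step_ge0 (R : numDomainType) (l : R) f T :
  0 <= l -> (forall s, 0 <= f s) -> 0 <= geom_step l f T.
Proof. by move=> l0 f0; elim: T => //= T IH; rewrite addr_ge0 ?mulr_ge0. Qed.

Lemma geom_conv_ge0 (R : numDomainType) (L : seq R) T :
  all (fun l => 0 <= l) L -> 0 <= geom_conv L T.
Proof.
elim: L T => [|l L IH] T /=; first by move=> _; apply: ler0n.
by move=> /andP[l0 L0]; apply: geom_step_ge0 => // s; apply: IH.
Qed.

(** Since [X / (1 - z X)] has [z]-derivative equal to its own square, differentiating its [i]-th
    power adds one more factor. *)
Lemma is_derive_geom_conv (R : realType) (L : seq R) i T (z : R) :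
  is_derive z (1 : R) (fun z => geom_conv (nseq i z ++ L) T)
    (i%:R * geom_conv (nseq i.+1 z ++ L) T).
Proof.
elim: T i => [|T IH] [|i].
- by rewrite mul0r; apply: is_derive_cst.
- by rewrite /= mulr0; apply: is_derive_cst.
- by rewrite mul0r; apply: is_derive_cst.
have d1 := IH i.+1; have d2 := IH i.
apply: (is_derive_eq
  (is_deriveD (is_deriveM (is_derive_id z (1 : R)) d1) d2)).
rewrite /= -(natr1 i) /GRing.scale /=; ring.
Qed.

(** * Replacing the rates by a common rate *)

Section Smoothing.
Variable R : realType.
Implicit Types (L : seq R) (l w z : R).

(* At an interior maximum in [w] of [(1 - w) ^+ i * geom_conv (nseq i w ++ l :: L) T],
   the vanishing of the derivative says exactly that [1 - l] times this value is
   [(1 - w) ^+ i.+1 * geom_conv (nseq i.+1 w ++ L) T]. *)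
Lemma geom_conv_smooth l z L i T (c B : R) : l <= z <= 1 -> 0 <= c -> 0 <= B ->
  (forall w, l <= w <= 1 ->
    c * ((1 - w) ^+ i.+1 * geom_conv (nseq i.+1 w ++ L) T) <= B) ->
  (1 - l) * c * ((1 - z) ^+ i * geom_conv (nseq i z ++ l :: L) T) <= B.
Proof.
move=> /andP[lz z1] c0 B0 leB; have l1 := le_trans lz z1.
have atl : (1 - l) * c * ((1 - l) ^+ i * geom_conv (nseq i l ++ l :: L) T) <= B.
  rewrite geom_conv_middle; have := leB l; rewrite lexx l1 => /(_ isT) /=.
  by rewrite exprS; apply: le_trans; rewrite le_eqVlt; apply/orP; left; apply/eqP; ring.
(* For [i = 0] the quantity to bound does not involve [z], so [atl] is already the goal. *)
case: i leB atl => [//|i] leB atl.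
pose u w := geom_conv (nseq i.+1 w ++ l :: L) T.
pose P w := geom_conv (nseq i.+2 w ++ l :: L) T.
pose v w := (1 - w) ^+ i.+1 * u w.
have dv w : is_derive w (1 : R) v
    (i.+1%:R * (1 - w) ^+ i * ((1 - w) * P w - u w)).
  have d1 : is_derive w (1 : R) (fun w => 1 - w) (-1).
    apply: (is_derive_eq (is_deriveB (is_derive_cst (1 : R) w (1 : R))
      (is_derive_id w (1 : R)))).
    by rewrite sub0r.
  have d2 := is_deriveX i.+1 d1.
  have d3 := is_derive_geom_conv (l :: L) i.+1 T w.
  have -> : v = (fun w => 1 - w) ^+ i.+1 * u by apply/funext => x; rewrite fctE exprfctE.
  apply: (is_derive_eq (is_deriveM d2 d3)).
  by rewrite exprfctE -/(P w) -/(u w) -[_.+1.-1]/i exprS -![_ *: _]/(_ * _); ring.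
have cv : {within `[l, 1], continuous v}.
  by apply: derivable_within_continuous => w _; have := dv w; case.
have [m mI vm] := EVT_max l1 cv.
apply: (@le_trans _ _ ((1 - l) * c * v m)).
  by rewrite ler_wpM2l ?mulr_ge0 ?subr_ge0 ?vm // in_itv /= lz z1.
(* If the maximum is at [l], [atl] concludes; at [1] the function [v] vanishes because its exponent
   is positive. *)
move: (mI); rewrite in_itv /= => /andP[]; rewrite le_eqVlt => /predU1P[<- //|lm].
rewrite le_eqVlt => /predU1P[->|m1]; first by rewrite /v subrr expr0n /= mul0r mulr0.
have := leB m; rewrite (ltW lm) (ltW m1) => /(_ isT); set W := geom_conv _ T.
have diff : (m - l) * P m = W - u m.
  rewrite /P /u !geom_conv_middle -(geom_conv_diff m l (nseq i.+1 m ++ L)).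
  by congr (_ * _); apply: geom_step_comm.
have d0 : is_derive m (1 : R) v 0.
  apply: (derive1_at_max l1); first by move=> w _; have := dv w; case.
    by rewrite in_itv /= lm m1.
  by move=> w wI; apply: vm; apply: subset_itv_oo_cc wI.
have : i.+1%:R * (1 - m) ^+ i * ((1 - m) * P m - u m) = 0.
  by have [_ <-] := dv m; have [_ ->] := d0.
move=> /eqP; rewrite mulf_eq0 mulf_eq0 pnatr_eq0 /= expf_eq0 subr_eq0 gt_eqF // andbF /=.
rewrite subr_eq0 => /eqP uE.
have -> : (1 - l) * c * v m = c * ((1 - m) ^+ i.+2 * W); last by [].
(* Combine the critical point equation [u m = (1 - m) * P m] with [W = u m + (m - l) * P m]. *)
have e : (1 - l) * u m = (1 - m) * W.
  have -> : W = u m + (m - l) * P m by rewrite diff addrC subrK.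
  by rewrite -uE; ring.
rewrite exprSr -[RHS]/(c * ((1 - m) ^+ i.+1 * (1 - m) * W)) /v -(mulrA _ (1 - m)) -e; ring.
Qed.

(** The [i] rates already merged share the value [z]. Merging the head [l], the largest remaining
    rate, moves the common value to some [w] in [[l, 1]], which still dominates the rest of [L], so
    the induction goes on. *)
Lemma geom_conv_le_nseq L i z T (B : R) :
  all (fun l => 0 <= l < 1) L -> sorted >=%R L -> all (<= z) L ->
  0 <= z <= 1 -> 0 <= B ->
  (forall w, 0 <= w <= 1 ->
    (1 - w) ^+ (i + size L) * geom_conv (nseq (i + size L) w) T <= B) ->
  \prod_(l <- L) (1 - l) * ((1 - z) ^+ i * geom_conv (nseq i z ++ L) T) <= B.
Proof.
elim: L i z => [|l L IH] i z /=.
  by move=> _ _ _ zI _ leB; rewrite big_nil mul1r cats0; have := leB z zI; rewrite addn0.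
move=> /andP[/andP[l0 l1] L01] pL /andP[lz Lz] /andP[z0 z1] B0 leB.
rewrite big_cons; apply: geom_conv_smooth => //; first by rewrite lz z1.
  rewrite big_seq prodr_ge0 // => w wL.
  by have /andP[_ /ltW] := allP L01 _ wL; rewrite subr_ge0.
move=> w /andP[lw w1]; apply: IH => //.
- exact: path_sorted pL.
- apply/allP => x xL; apply: le_trans lw.
  by have /allP := order_path_min ge_trans pL; apply.
- by rewrite (le_trans l0 lw) w1.
- by move=> x xI; rewrite addSnnS; apply: leB.
Qed.

Lemma geom_conv_le L T (B : R) : all (fun l => 0 <= l < 1) L -> 0 <= B ->
  (forall w, 0 <= w <= 1 ->
    (1 - w) ^+ size L * geom_conv (nseq (size L) w) T <= B) ->
  \prod_(l <- L) (1 - l) * geom_conv L T <= B.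
Proof.
move=> L01 B0 leB; have pL : perm_eq L (sort >=%R L) by rewrite perm_sym perm_sort perm_refl.
rewrite (perm_big _ pL) (geom_conv_perm pL) -[geom_conv _ _]mul1r.
(* Start with no merged rate and [z = 1], which dominates every rate. *)
rewrite -[X in X * geom_conv _ _](expr0 (1 - 1)).
apply: (geom_conv_le_nseq (i := 0)) => //.
- by rewrite -(perm_all _ pL).
- by apply: sort_sorted => x y; apply: ge_total.
- rewrite -(perm_all _ pL); apply: sub_all L01 => x /andP[_ /ltW //].
- by rewrite ler01 lexx.
- by rewrite size_sort.
Qed.

End Smoothing.

(** * The case of equal rates: binomial estimates *)

Section Binomial.
Variable R : realType.

Lemma weighted_AMGM a b (x y : R) : 0 <= x -> 0 <= y -> (0 < a + b)%N ->
  x ^+ a * y ^+ b <= ((a%:R * x + b%:R * y) / (a + b)%:R) ^+ (a + b).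
Proof.
move=> x0 y0 ab0.
pose E (i : 'I_a + 'I_b) := if i is inl _ then x else y.
have := @leif_AGM R ('I_a + 'I_b)%type predT E.
case=> [[] //|]; rewrite !big_sumType /= !prodr_const !sumr_const !card_sum !card_ord.
by rewrite !mulr_natl => + _.
Qed.

(** This is the bound [4^k / sqrt(2k + 1)], squared to stay in [nat]. The induction step amounts to
    [(2k + 1)(2k + 3) <= 4 (k + 1)^2]. *)
Lemma central_bin_le k : ((2 * k).+1 * 'C(2 * k, k) ^ 2 <= 16 ^ k)%N.
Proof.
elim: k => [//|k IH].
have eC : (k.+1 * 'C(2 * k.+1, k.+1) = 2 * (2 * k).+1 * 'C(2 * k, k))%N.
  have e1 := mul_bin_diag (2 * k).+2 k; have e2 := mul_bin_down (2 * k).+1 k.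
  rewrite /= in e1 e2; rewrite (_ : (2 * k.+1 = (2 * k).+2)%N); last by lia.
  have : (k.+1 * (k.+1 * 'C((2 * k).+2, k.+1)) = k.+1 * (2 * (2 * k).+1 * 'C(2 * k, k)))%N.
    rewrite -e1 (_ : k.+1 * (2 * _ * _) =
      (2 * k).+2 * ((2 * k).+1 * 'C(2 * k, k)))%N; last by lia.
    by rewrite e2 (_ : ((2 * k).+1 - k = k.+1)%N); [lia | lia].
  by move/eqP; rewrite eqn_pmul2l // => /eqP.
rewrite -(@leq_pmul2l (k.+1 ^ 2)) // [(16 ^ _)%N]expnS.
set C := 'C(2 * k.+1, k.+1) in eC *; set D := 'C(2 * k, k) in eC IH.
have -> : (k.+1 ^ 2 * ((2 * k.+1).+1 * C ^ 2) = (2 * k.+1).+1 * (k.+1 * C) ^ 2)%N by lia.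
rewrite eC; set X := (16 ^ k)%N in IH *.
have : ((2 * k.+1).+1 * (2 * (2 * k).+1 * D) ^ 2 =
  (4 * (2 * k.+1).+1 * (2 * k).+1) * ((2 * k).+1 * D ^ 2))%N by lia.
move=> ->; apply: leq_trans (leq_mul (leqnn _) IH) _.
by rewrite mulnA leq_mul2r; apply/orP; right; nia.
Qed.

(** For fixed [T] the mass is largest at [w = (T - k) / T], with value [b (T - k)]. This value
    decreases with [T], so the worst case is [T = 2 k], a central binomial probability. *)
Lemma bin_pmf_le k T (w : R) : (0 < k)%N -> (2 * k <= T)%N -> 0 <= w <= 1 ->
  'C(T, k)%:R * (w ^+ (T - k) * (1 - w) ^+ k) <= (Num.sqrt (2 * k%:R))^-1.
Proof.
move=> k0 kT /andP[w0 w1].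
pose b u : R := 'C(u + k, k)%:R * u%:R ^+ u * k%:R ^+ k / (u + k)%:R ^+ (u + k).
have wb : 'C(T, k)%:R * (w ^+ (T - k) * (1 - w) ^+ k) <= b (T - k)%N.
  have u0 : (0 < T - k)%N by lia.
  have kR : 0 < k%:R :> R by rewrite ltr0n.
  have uR : 0 < (T - k)%:R :> R by rewrite ltr0n.
  rewrite /b (_ : (T - k + k = T)%N) -?mulrA ?ler_wpM2l //; last by lia.
  have := @weighted_AMGM (T - k) k (w / (T - k)%:R) ((1 - w) / k%:R).
  rewrite !divr_ge0 ?subr_ge0 ?ler0n // => /(_ isT isT).
  rewrite (_ : (T - k + k = T)%N) //; last by lia.
  rewrite (_ : (0 < T)%N) => [/(_ isT)|]; last by lia.
  have e1 : (T - k)%:R * (w / (T - k)%:R) = w by rewrite mulrC divfK ?gt_eqF.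
  have e2 : k%:R * ((1 - w) / k%:R) = 1 - w by rewrite mulrC divfK ?gt_eqF.
  rewrite e1 e2 [w + _]addrC subrK !exprMn !exprVn expr1n mul1r.
  rewrite mulrACA -invfM ler_pdivrMr ?mulr_gt0 ?exprn_gt0 //.
  by rewrite [T%:R ^- T * _]mulrC mulrA.
apply: le_trans wb _.
have mono u : (0 < u)%N -> b u.+1 <= b u.
  move=> u0; rewrite /b addSn.
  have uR : 0 < u%:R :> R by rewrite ltr0n.
  have ukR : 0 < (u + k)%:R :> R by rewrite ltr0n; lia.
  have eC : ('C((u + k).+1, k) * u.+1 = (u + k).+1 * 'C(u + k, k))%N.
    by have := mul_bin_down (u + k).+1 k; rewrite /= (_ : ((u + k).+1 - k = u.+1)%N); lia.
  have {}eC : ('C((u + k).+1, k)%:R * u.+1%:R = (u + k).+1%:R * 'C(u + k, k)%:R :> R).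
    by rewrite -!natrM eC.
  rewrite ler_pdivrMr ?exprn_gt0 // [X in _ <= X]mulrAC ler_pdivlMr ?exprn_gt0 //.
  (* AM-GM for [u] copies of [(u + 1) / u] and [k] copies of [1], whose mean is
     [(u + k + 1) / (u + k)]. *)
  have key : u.+1%:R ^+ u * (u + k)%:R ^+ (u + k) <= u%:R ^+ u * (u + k).+1%:R ^+ (u + k) :> R.
    have := @weighted_AMGM u k (u.+1%:R / u%:R) 1.
    rewrite ler01 divr_ge0 ?ler0n // => /(_ isT isT).
    rewrite (_ : (0 < u + k)%N) => [/(_ isT)|]; last by lia.
    have e : u%:R * (u.+1%:R / u%:R) = u.+1%:R :> R by rewrite mulrC divfK ?gt_eqF.
    rewrite e !mulr1 !expr1n mulr1 -natrD addSn !expr_div_n.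
    rewrite ler_pdivrMr ?exprn_gt0 // [X in _ <= X]mulrAC ler_pdivlMr ?exprn_gt0 //.
    by rewrite [X in _ <= X]mulrC.
  rewrite !exprS.
  have -> : 'C((u + k).+1, k)%:R * (u.+1%:R * u.+1%:R ^+ u) * k%:R ^+ k * (u + k)%:R ^+ (u + k)
    = 'C((u + k).+1, k)%:R * u.+1%:R * k%:R ^+ k *
      (u.+1%:R ^+ u * (u + k)%:R ^+ (u + k)) :> R by ring.
  rewrite eC.
  have -> : 'C(u + k, k)%:R * u%:R ^+ u * k%:R ^+ k *
      ((u + k).+1%:R * (u + k).+1%:R ^+ (u + k))
    = (u + k).+1%:R * 'C(u + k, k)%:R * k%:R ^+ k *
      (u%:R ^+ u * (u + k).+1%:R ^+ (u + k)) :> R by ring.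
  by rewrite ler_wpM2l // !mulr_ge0 ?exprn_ge0 ?ler0n.
have : b (T - k)%N <= b k.
  rewrite (_ : (T - k = (T - 2 * k) + k)%N); last by lia.
  elim: (T - 2 * k)%N => [//|j IH]; apply: le_trans IH; rewrite addSn; apply: mono; lia.
move=> /le_trans; apply.
have kR : 0 < k%:R :> R by rewrite ltr0n.
have -> : b k = 'C(2 * k, k)%:R / 4 ^+ k.
  rewrite /b addnn -mul2n natrM exprMn.
  have -> : (2 : R) ^+ (2 * k) = 4 ^+ k by rewrite exprM -natrX.
  rewrite mul2n -addnn exprD.
  by field; rewrite !expf_neq0 ?gt_eqF.
rewrite ler_pdivrMr ?exprn_gt0 // mulrC ler_pdivlMr ?sqrtr_gt0 ?mulr_gt0 //.
rewrite -(@ler_sqr _ (_ * _)) ?nnegrE ?mulr_ge0 ?sqrtr_ge0 ?exprn_ge0 //.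
rewrite exprMn sqr_sqrtr ?mulr_ge0 //.
have : ((2 * k).+1 * 'C(2 * k, k) ^ 2)%:R <= (16 ^ k)%:R :> R.
  by rewrite ler_nat central_bin_le.
have -> : (4 ^+ k ^+ 2 : R) = (16 ^ k)%:R by rewrite -exprM mulnC exprM -natrX -natrX.
apply: le_trans; rewrite mulrC natrM natrX ler_wpM2r ?exprn_ge0 ?ler0n //.
by rewrite -natrM ler_nat.
Qed.

(** As ['C(T - 1, k - 1)] is [k / T] times ['C(T, k)], the mass is [k / T] times a binomial mass,
    and [k / sqrt(2k) = sqrt(k / 2)]. *)
Lemma geom_conv_nseq_le k T (w : R) : (2 * k <= T)%N -> (0 < T)%N -> 0 <= w <= 1 ->
  (1 - w) ^+ k * geom_conv (nseq k w) T <= Num.sqrt (k%:R / 2) / T%:R.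
Proof.
case: k => [|k] kT T0 w01.
  by rewrite /= eqn0Ngt T0 /= mulr0 mul0r sqrtr0 mul0r.
case: T T0 kT => // T _ kT.
have kR : 0 < k.+1%:R :> R by rewrite ltr0n.
rewrite geom_conv_nseq ler_pdivlMr ?ltr0n //.
have /(congr1 (fun n => n%:R : R)) := mul_bin_diag T.+1 k; rewrite /= !natrM => eC.
have := bin_pmf_le _ kT w01 => /(_ isT); rewrite subSS -(ler_pM2l kR).
have -> : k.+1%:R * (Num.sqrt (2 * k.+1%:R))^-1 = Num.sqrt (k.+1%:R / 2) :> R.
  apply: (canLR (mulfK _)); first by rewrite sqrtr_eq0 -ltNge mulr_gt0.
  rewrite -sqrtrM ?divr_ge0 // (_ : _ * _ = k.+1%:R ^+ 2); last by field.
  by rewrite sqrtr_sqr ger0_norm.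
move=> /(le_trans _); apply; rewrite [X in _ <= X]mulrA -eC.
by rewrite le_eqVlt; apply/orP; left; apply/eqP; ring.
Qed.
End Binomial.

(** * Mixtures of sums of geometric times *)

Section Mixture.
Variable R : realType.
Implicit Types (L : seq R) (f : nat -> R).

(** The partial sums satisfy [a (K + 1) = l * a K + series f K]. They increase and stay below
    [s / (1 - l)], so they converge, and the limit solves [x = l * x + s]. *)
Lemma cvg_series_geom_step (l : R) f (s : R) : 0 <= l < 1 -> (forall T, 0 <= f T) ->
  series f @ \oo --> s -> series (geom_step l f) @ \oo --> s / (1 - l).
Proof.
move=> /andP[l0 l1] f0 fs; have l10 : 0 < 1 - l by rewrite subr_gt0.
have g0 T : 0 <= geom_step l f T by apply: geom_step_ge0.
pose a := series (geom_step l f).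
have aS K : a K.+1 = l * a K + series f K.
  rewrite /a /series /= !big_mkord big_ord_recl /= add0r mulr_sumr -big_split.
  by apply: eq_bigr.
have fle K : series f K <= s.
  have cvf : cvgn (series f) by apply/cvg_ex; exists s.
  rewrite -(cvg_lim (@Rhausdorff R) fs); apply: nondecreasing_cvgn_le => //.
  exact: nondecreasing_series.
have ale K : a K <= s / (1 - l).
  elim: K => [|K IH].
    rewrite /a /series /= big_geq // divr_ge0 ?(ltW l10) //.
    by have := fle 0; rewrite /series /= big_geq.
  rewrite aS; apply: le_trans (lerD (ler_wpM2l l0 IH) (fle K)) _.
  by rewrite le_eqVlt; apply/orP; left; apply/eqP; field; rewrite gt_eqF.
have cva : cvgn a.
  apply: nondecreasing_is_cvgn; first exact: nondecreasing_series.
  by exists (s / (1 - l)) => _ [K _ <-].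
have [x ax] : exists x : R, a @ \oo --> x by exists (limn a).
suff -> : s / (1 - l) = x by [].
have aSx : (fun K => a K.+1) @ \oo --> x by rewrite (cvg_shiftS a).
have : (fun K => a K.+1) @ \oo --> l * x + s.
  rewrite (_ : (fun K => _) = (fun K => l * a K + series f K)); last by apply/funext.
  by apply: cvgD => //; apply: cvgMl_tmp.
move=> /(cvg_unique (@Rhausdorff R) aSx) e.
by apply: (canLR (mulfK _)); [rewrite gt_eqF | rewrite mulrBr mulr1 {1}e; ring].
Qed.

Lemma cvg_series_geom_conv L : all (fun l => 0 <= l < 1) L ->
  series (geom_conv L) @ \oo --> \prod_(l <- L) (1 - l)^-1.
Proof.
elim: L => [_|l L IH /= /andP[l01 L01]].
  rewrite big_nil -(cvg_shiftS (series _)); apply: cvg_near_cst; near=> K.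
  rewrite /series /= big_mkord big_ord_recl big1 ?addr0 // => i _.
rewrite big_cons mulrC; apply: cvg_series_geom_step => //; last exact: IH.
move=> T; apply: geom_conv_ge0; apply: sub_all L01 => x /andP[].
Unshelve. all: by end_near. Qed.

(** The weights are not normalised: a component [e.2] has total mass equal to the product of the
    [1 / (1 - l)], and only [e.1] times this mass acts as a probability. *)
Definition geom_mixture (k : nat) f := exists2 r : seq (R * seq R),
  {in r, forall e, [/\ 0 <= e.1, (size e.2 <= k)%N & all (fun l => 0 <= l < 1) e.2]} &
  f =1 (fun T => \sum_(e <- r) e.1 * geom_conv e.2 T).

Lemma geom_mixture_delta k : geom_mixture k (fun T => (T == 0)%:R).
Proof.
exists [:: (1, [::])]; first by move=> e; rewrite inE => /eqP ->; split=> //=; apply: ler01.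
by move=> T; rewrite big_seq1 mul1r.
Qed.

Lemma geom_mixture_scale_add k (c : R) f g : 0 <= c ->
  geom_mixture k f -> geom_mixture k g -> geom_mixture k (fun T => c * f T + g T).
Proof.
move=> c0 [r rr rE] [s ss sE].
exists ([seq (c * e.1, e.2) | e <- r] ++ s) => [e|T].
  rewrite mem_cat => /orP[/mapP[e' e'r ->]|/ss //].
  by have [? ? ?] := rr _ e'r; split=> //=; rewrite mulr_ge0.
rewrite rE sE big_cat big_map mulr_sumr; congr (_ + _).
by apply: eq_bigr => e _; rewrite mulrA.
Qed.

Lemma eq_geom_mixture k f g : f =1 g -> geom_mixture k f -> geom_mixture k g.
Proof. by move=> fg [r rr rE]; exists r => // T; rewrite -fg. Qed.

Lemma geom_mixture_sum k (I : Type) (r : seq I) (P : pred I) (c : I -> R) (f : I -> nat -> R) :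
  (forall i, P i -> 0 <= c i) -> (forall i, P i -> geom_mixture k (f i)) ->
  geom_mixture k (fun T => \sum_(i <- r | P i) c i * f i T).
Proof.
move=> c0 fm; elim: r => [|i r IH].
  by exists [::] => // T; rewrite !big_nil.
case Pi : (P i).
  apply: eq_geom_mixture (geom_mixture_scale_add (c0 i Pi) (fm i Pi) IH) => T.
  by rewrite big_cons Pi.
by apply: eq_geom_mixture IH => T; rewrite big_cons Pi.
Qed.

Lemma geom_mixture_step k (l : R) f : 0 <= l < 1 -> geom_mixture k f ->
  geom_mixture k.+1 (geom_step l f).
Proof.
move=> l01 [r rr rE]; exists [seq (e.1, l :: e.2) | e <- r] => [e|T].
  by move=> /mapP[e' e'r ->]; have [? ? ?] := rr _ e'r; split=> //=; rewrite l01.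
by rewrite (eq_geom_step _ rE) geom_step_sum big_map.
Qed.

Lemma geom_mixture_le k f T : geom_mixture k f ->
  (forall K, \sum_(0 <= s < K) f s <= 1) -> (2 * k <= T)%N -> (0 < T)%N ->
  f T <= Num.sqrt (k%:R / 2) / T%:R.
Proof.
move=> [r rr fE] f1 kT T0; set B := Num.sqrt _ / _.
have B0 : 0 <= B by rewrite divr_ge0 ?sqrtr_ge0.
pose g (e : R * seq R) : R := \prod_(l <- e.2) (1 - l)^-1.
(* The normalised weights add up to the total mass of [f]; let [K] tend to infinity in the bound on
   its partial sums. *)
have g1 : \sum_(e <- r) e.1 * g e <= 1.
  have cv : (fun K => \sum_(e <- r) e.1 * series (geom_conv e.2) K) @ \oo
      --> \sum_(e <- r) e.1 * g e.
    rewrite big_seq; under eq_fun do rewrite big_seq.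
    apply: cvg_big => [|e er]; first exact: add_continuous.
    apply: cvgMl_tmp; apply: cvg_series_geom_conv.
    by have [] := rr _ er.
  apply: (cvgr_to_le cv); apply: nearW => K; apply: le_trans (f1 K).
  rewrite le_eqVlt; apply/orP; left; apply/eqP.
  under [RHS]eq_bigr do rewrite fE.
  by rewrite exchange_big; apply: eq_bigr => e _; rewrite /series /= mulr_sumr.
apply: (@le_trans _ _ (\sum_(e <- r) e.1 * g e * B)); last first.
  by rewrite -mulr_suml ler_piMl.
rewrite fE big_seq [leRHS]big_seq; apply: ler_sum => e er.
have [e0 ek e01] := rr _ er; rewrite -mulrA ler_wpM2l //.
have p0 : 0 < \prod_(l <- e.2) (1 - l).
  rewrite big_seq prodr_gt0 // => l le; rewrite subr_gt0.
  by have /andP[] := allP e01 _ le.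
rewrite /g prodfV mulrC ler_pdivlMr // mulrC; apply: geom_conv_le => // w w01.
apply: le_trans (geom_conv_nseq_le _ T0 w01) _.
  exact: leq_trans (leq_mul (leqnn 2) ek) kT.
by rewrite ler_wpM2r ?invr_ge0 // ler_wsqrtr // ler_wpM2r // ler_nat.
Qed.

End Mixture.

(** * Loop erasure for symmetrizable kernels *)

Section Spectral.
Import complex.
Local Open Scope sesquilinear_scope.

Lemma ge0_complexE (R : rcfType) (z : R[i]) : 0 <= z -> z = (complex.Re z)%:C%C.
Proof. by case: z => a b; rewrite lecE /= => /andP[/eqP -> _]. Qed.

Lemma ge0_Re (R : rcfType) (z : R[i]) : 0 <= z -> 0 <= complex.Re z.
Proof. by case: z => a b; rewrite lecE /= => /andP[]. Qed.

(** Diagonalise [B^T *m B] by a unitary matrix [P] over [R[i]]: the [l j] are the eigenvalues and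
    the [w j] the squared moduli of the entries of column [x] of [P]. *)
Lemma gram_exp_diag (R : rcfType) m n (B : 'M[R]_(m, n)) (x : 'I_n) :
  exists w l : 'I_n -> R, [/\ forall j, 0 <= w j, forall j, 0 <= l j &
    forall t, ((B^T *m B) ^+ t) x x = \sum_j w j * l j ^+ t].
Proof.
pose Bc := map_mx (real_complex R) B; pose A := Bc^t* *m Bc.
have trBc : Bc^t* = map_mx (real_complex R) B^T.
  by apply/matrixP => i j; rewrite !mxE; apply: conjc_real.
have nA : A \is normalmx.
  apply/normalmxP; suff -> : A ^t* = A by [].
  by rewrite /A trmx_mul map_mxM trmxCK.
have /orthomx_spectralP := nA; rewrite invmx_unitary ?spectral_unitarymx //.
set P := spectralmx A; set d := spectral_diag A => AE.
have PU : P *m P^t* = 1%:M by apply/unitarymxP/spectral_unitarymx.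
have AX t : A ^+ t = P^t* *m diag_mx (\row_j d 0 j ^+ t) *m P.
  elim: t => [|t IH].
    rewrite expr0 (_ : \row_j _ = const_mx 1).
      by rewrite diag_const_mx mulmx1; apply/esym/mulmx1C.
    by apply/rowP => j; rewrite !mxE expr0.
  rewrite exprS -[_ * _]/(_ *m _) IH {1}AE !mulmxA -(mulmxA _ P) PU mulmx1.
  rewrite -(mulmxA _ (diag_mx _) (diag_mx _)).
  congr (_ *m _ *m _); rewrite mulmx_diag; congr diag_mx.
  by apply/rowP => j; rewrite !mxE exprS.
(* [diag_mx d] is itself the Gram matrix of [Bc *m P^t*], so its diagonal entries are sums of
   squared moduli. *)
have d0 j : 0 <= d 0 j.
  have : diag_mx d = (Bc *m P^t*)^t* *m (Bc *m P^t*).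
    rewrite trmx_mul map_mxM trmxCK !mulmxA -(mulmxA P) -/A AE !mulmxA PU mul1mx.
    by rewrite -mulmxA PU mulmx1.
  move=> /matrixP/(_ j j); rewrite [LHS]mxE eqxx mulr1n => ->.
  by rewrite mxE sumr_ge0 // => k _; rewrite !mxE mulrC mul_conjC_ge0.
exists (fun j => complex.Re (P j x * (P j x)^*)), (fun j => complex.Re (d 0 j)).
split=> [j|j|t].
- exact/ge0_Re/mul_conjC_ge0.
- exact: ge0_Re.
apply: (@complexI R); rewrite rmorph_sum /=.
have -> : (((B^T *m B) ^+ t) x x)%:C%C = (A ^+ t) x x.
  suff <- : map_mx (real_complex R) ((B^T *m B) ^+ t) = A ^+ t by rewrite mxE.
  rewrite /A trBc -map_mxM; move: (B^T *m B) => M; elim: t => [|t IH].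
    by rewrite !expr0 map_mx1.
  by rewrite !exprS -IH; apply: map_mxM.
rewrite AX !mxE; apply: eq_bigr => j _.
rewrite rmorphM rmorphXn /= -!ge0_complexE ?mul_conjC_ge0 //.
rewrite mxE (bigD1 j) //= big1 ?addr0; last first.
  by move=> k /negbTE kj; rewrite !mxE kj mulr0n mulr0.
by rewrite !mxE eqxx mulr1n mulrAC [_^* * _]mulrC.
Qed.
End Spectral.

(** * Decomposition at the last visit *)

Section LastExit.
Variables (R : realType) (n : nat).
Implicit Types (D : {set 'I_n}) (A : 'M[R]_n) (kappa : 'cV[R]_n).

Definition set_mx D : 'M[R]_n := diag_mx (\row_i (i \in D)%:R).

Definition restr D A : 'M[R]_n := set_mx D *m A *m set_mx D.

Lemma restrE D A i j : restr D A i j = (i \in D)%:R * A i j * (j \in D)%:R.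
Proof. by rewrite /restr /set_mx mul_mx_diag mul_diag_mx !mxE. Qed.

Lemma restr_setT A : restr [set: 'I_n] A = A.
Proof. by apply/matrixP => i j; rewrite restrE !inE mul1r mulr1. Qed.

(* The mass killed at time [T] when [A] is run inside [D] from [x] and the move
   killing the chain in state [z] has weight [kappa z 0]. *)
Definition exit A kappa D x (T : nat) : R :=
  if T is T'.+1 then ((restr D A) ^+ T' *m kappa) x 0 else 0.

(** The last visit to [x] is at time [T - s]. Either [s = 0] and the chain is killed from [x], or it
    jumps to some [z] and is killed [s] steps later without meeting [x]; the boundary term is
    harmless because [exit] is [0] at time [0]. *)
Lemma last_exit A kappa D x T : x \in D ->
  exit A kappa D x T.+1 = \sum_(s < T.+1) ((restr D A) ^+ (T - s)) x x *
    ((s == 0 :> nat)%:R * kappa x 0 +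
     \sum_(z in D :\ x) A x z * exit A kappa (D :\ x) z s).
Proof.
move=> xD; pose AD := restr D A; pose AE := restr (D :\ x) A.
pose q : 'rV[R]_n := \row_z ((z \in D :\ x)%:R * A x z).
(* [rho s] weighs the end points of the walks of [s] steps from [x] that never return to [x]. *)
pose rho s : 'rV[R]_n := if s is s'.+1 then q *m AE ^+ s' else delta_mx 0 x.
have qx0 s : (q *m AE ^+ s) 0 x = 0.
  case: s => [|s]; first by rewrite expr0 mulmx1 mxE !inE eqxx mul0r.
  rewrite exprSr -[_ * _]/(_ *m _) mulmxA mxE big1 // => z _.
  by rewrite [AE _ _]restrE !inE eqxx mulr0 mulr0.
have rhox0 s : rho s.+1 0 x = 0 := qx0 s.
(* One more step inside [D] either avoids [x] or returns to it. *)
have rhoS s : rho s *m AD = rho s.+1 + ((rho s *m AD) 0 x) *: delta_mx 0 x.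
  apply/rowP => j; rewrite [RHS]mxE [in X in _ = _ + X]mxE [delta_mx _ _ _ _]mxE eqxx /=.
  have [->|jx] := eqVneq j x; first by rewrite qx0 add0r mulr1.
  rewrite mulr0 addr0; case: s => [|s].
    rewrite [rho _]/(delta_mx 0 x) expr0 mulmx1 -rowE.
    by rewrite [LHS]mxE [RHS]mxE [AD _ _]restrE xD mul1r mulrC !inE jx.
  rewrite exprSr -[_ * _]/(_ *m _) [in RHS]mulmxA mxE [RHS]mxE; apply: eq_bigr => i _.
  have [->|ix] := eqVneq i x; first by rewrite qx0 !mul0r.
  by rewrite !restrE !inE ix jx.
have key t : row x (AD ^+ t) = \sum_(s < t.+1) (AD ^+ (t - s)) x x *: rho s.
  elim: t => [|t IH].
    by rewrite big_ord1 subnn expr0 mxE eqxx scale1r row1.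
  have rS : row x (AD ^+ t.+1) = \sum_(s < t.+1) (AD ^+ (t - s)) x x *: rho s.+1 +
      (\sum_(s < t.+1) (AD ^+ (t - s)) x x * (rho s *m AD) 0 x) *: delta_mx 0 x.
    rewrite exprSr -[_ * _]/(_ *m _) row_mul IH mulmx_suml scaler_suml -big_split.
    by apply: eq_bigr => s _; rewrite -scalemxAl {1}rhoS scalerDr scalerA.
  rewrite big_ord_recl subn0.
  rewrite [in X in _ = _ + X](eq_bigr (fun s : 'I_t.+1 => (AD ^+ (t - s)) x x *: rho s.+1)) //.
  rewrite addrC rS; congr (_ + _ *: _).
  (* Reading entry [x] of [rS] identifies the coefficient of [delta_mx 0 x], since every [rho s.+1]
     vanishes there. *)
  have := congr1 (fun r : 'rV[R]_n => r 0 x) rS; rewrite [LHS]mxE => ->.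
  rewrite [RHS]mxE [X in _ = X + _]summxE [X in _ = X + _]big1 ?add0r.
    by rewrite [RHS]mxE [delta_mx _ _ _ _]mxE !eqxx mulr1.
  by move=> s _; rewrite mxE rhox0 mulr0.
rewrite [LHS](_ : _ = (row x (AD ^+ T) *m kappa) 0 0); last first.
  by rewrite -row_mul mxE.
rewrite key mulmx_suml summxE; apply: eq_bigr => -[[|s] sT] _; rewrite -scalemxAl mxE.
  rewrite /= -rowE mxE mul1r big1 ?addr0 // => z _; exact: mulr0.
rewrite /= mul0r add0r -mulmxA mxE; congr (_ * _).
rewrite [RHS]big_mkcond; apply: eq_bigr => z _; rewrite mxE.
by case: ifP; rewrite ?mul1r // !mul0r.
Qed.

(* Splitting at the last visit to [x] turns the loops at [x] into a geometric
   time with a random rate and leaves a walk avoiding [x] afterwards. *)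
Lemma exit_mixture A kappa D x :
  (forall i j, 0 <= A i j) -> (forall i, 0 <= kappa i 0) ->
  (forall D x, x \in D -> exists w l : 'I_n -> R,
    [/\ forall j, 0 <= w j, forall j, 0 <= l j < 1 &
        forall t, ((restr D A) ^+ t) x x = \sum_j w j * l j ^+ t]) ->
  x \in D -> geom_mixture #|D| (exit A kappa D x).
Proof.
move=> A0 k0 moments; have [m] := ubnP #|D|; elim: m D x => // m IH D x Dm xD.
have [w [l [w0 l01 wl]]] := moments D x xD.
have cardD : #|D| = #|D :\ x|.+1 by rewrite (cardsD1 x) xD.
(* [e] is the part after the last visit to [x]; it needs one geometric factor fewer, as it lives on
   [D :\ x]. *)
pose e s := kappa x 0 * (s == 0)%:R +
  \sum_(z in D :\ x) A x z * exit A kappa (D :\ x) z s.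
have em : geom_mixture #|D :\ x| e.
  apply: geom_mixture_scale_add => //; first exact: geom_mixture_delta.
  apply: geom_mixture_sum => // z zD; apply: IH => //.
  by rewrite cardD in Dm.
rewrite cardD; apply: (@eq_geom_mixture _ _ (fun T => \sum_j w j * geom_step (l j) e T)).
  case=> [|T]; first by rewrite big1 // => j _; rewrite mulr0.
  rewrite last_exit //; under [RHS]eq_bigr do rewrite wl mulr_suml.
  rewrite exchange_big; apply: eq_bigr => j _; rewrite geom_stepE mulr_sumr.
  by apply: eq_bigr => s _; rewrite /e [kappa x 0 * _]mulrC mulrA.
by apply: geom_mixture_sum => // j _; apply: geom_mixture_step.
Qed.

End LastExit.

(** * Killing times of symmetrizable kernels *)

Section SymmetrizableExit.
Variables (R : realType) (n : nat).
Implicit Types (A M : 'M[R]_n) (kappa : 'cV[R]_n).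

Lemma mx_exp_row_sum A (rho : R) t :
  (forall i j, 0 <= A i j) -> (forall i, \sum_j A i j <= rho) ->
  (forall i j, 0 <= (A ^+ t) i j) /\ (forall i, \sum_j (A ^+ t) i j <= rho ^+ t).
Proof.
move=> A0 Arho; elim: t => [|t [IH0 IH]].
  split=> [i j|i]; first by rewrite expr0 mxE ler0n.
  rewrite !expr0 (bigD1 i) //= big1 ?addr0; first by rewrite mxE eqxx.
  by move=> j /negbTE ji; rewrite mxE eq_sym ji.
split=> i => [j|]; first by rewrite exprS mxE sumr_ge0 // => k _; rewrite mulr_ge0.
have rho0 : 0 <= rho by apply: le_trans (Arho i); apply: sumr_ge0.
rewrite exprS; under eq_bigr do rewrite mxE.
rewrite exchange_big /=.
apply: (@le_trans _ _ (\sum_k A i k * rho ^+ t)).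
  by apply: ler_sum => k _; rewrite -mulr_sumr ler_wpM2l.
by rewrite -mulr_suml exprS ler_wpM2r ?exprn_ge0.
Qed.

(** If [l > rho], then [(rho / l)^t] tends to [0] while staying at least [w]. *)
Lemma geometric_rate_le (w l rho : R) : 0 < w -> 0 <= rho ->
  (forall t, w * l ^+ t <= rho ^+ t) -> l <= rho.
Proof.
move=> w0 rho0 wl; rewrite leNgt; apply/negP => rl.
have l0 : 0 < l := le_lt_trans rho0 rl.
have cv : (fun t => (rho / l) ^+ t) @ \oo --> (0 : R).
  by apply: cvg_expr; rewrite ger0_norm ?divr_ge0 // ?(ltW l0) // ltr_pdivrMr // mul1r.
suff : w <= 0 by rewrite leNgt w0.
apply: (cvgr_to_ge cv); apply: nearW => t.
by rewrite expr_div_n ler_pdivlMr ?exprn_gt0.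
Qed.

(** Conjugation by a diagonal matrix commutes with restriction to [D] and preserves the diagonal of
    powers, and the restriction of a Gram matrix is again one. *)
Lemma restr_moments A (S : 'M[R]_n) (v : 'I_n -> R) (rho : R) D x :
  (forall i j, 0 <= A i j) -> (forall i, \sum_j A i j <= rho) -> 0 <= rho < 1 ->
  (forall i, 0 < v i) -> (forall i j, A i j = v j / v i * (S^T *m S) i j) ->
  exists w l : 'I_n -> R, [/\ forall j, 0 <= w j, forall j, 0 <= l j < 1 &
    forall t, ((restr D A) ^+ t) x x = \sum_j w j * l j ^+ t].
Proof.
move=> A0 Arho /andP[rho0 rho1] v0 AS.
have [w [l [w0 l0 wl]]] := gram_exp_diag (S *m set_mx R D) x.
have gE : (S *m set_mx R D)^T *m (S *m set_mx R D) = restr D (S^T *m S).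
  by rewrite trmx_mul /set_mx tr_diag_mx /restr !mulmxA.
have conj t i j : ((restr D A) ^+ t) i j = v j / v i * ((restr D (S^T *m S)) ^+ t) i j.
  elim: t j => [|t IH] j.
    rewrite !expr0 !mxE; case: eqP => [->|_]; last by rewrite !mulr0.
    by rewrite divff ?gt_eqF // mulr1.
  rewrite !exprSr [LHS]mxE [X in _ = _ * X]mxE mulr_sumr; apply: eq_bigr => k _.
  rewrite IH !restrE AS; field.
  by rewrite !gt_eqF.
have diagE t : ((restr D A) ^+ t) x x = \sum_j w j * l j ^+ t.
  by rewrite conj divff ?gt_eqF // mul1r -gE wl.
have restr0 i j : 0 <= restr D A i j by rewrite restrE !mulr_ge0.
have restr_rho i : \sum_j restr D A i j <= rho.
  apply: le_trans (Arho i); apply: ler_sum => j _; rewrite restrE.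
  by do 2!case: (_ \in D); rewrite ?mul1r ?mul0r ?mulr1 ?mulr0.
(* The row sums of powers bound only the rates of positive weight, so the others are reset to
   [0]. *)
exists w, (fun j => if w j == 0 then 0 else l j); split=> // [j|t].
  case: eqP => [_|/eqP wj]; first by rewrite lexx ltr01.
  rewrite l0 /=; apply: le_lt_trans rho1; apply: (@geometric_rate_le (w j)) => //.
    by rewrite lt_def wj w0.
  move=> t; have [X0 Xrho] := mx_exp_row_sum t restr0 restr_rho.
  apply: le_trans (Xrho x); rewrite [leRHS](bigD1 x) //= diagE (bigD1 j) //= -addrA.
  rewrite lerDl addr_ge0 // sumr_ge0 // => k _.
  by rewrite mulr_ge0 // exprn_ge0.
rewrite diagE; apply: eq_bigr => j _; case: eqP => [->|//].
by rewrite !mul0r.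
Qed.

Lemma sum_exit_le1 A kappa x K : (forall i j, 0 <= A i j) ->
  (forall i, kappa i 0 + \sum_j A i j <= 1) ->
  \sum_(0 <= T < K) exit A kappa [set: 'I_n] x T <= 1.
Proof.
move=> A0 kA; case: K => [|K]; first by rewrite big_geq ?ler01.
rewrite big_nat_recl //= add0r restr_setT.
elim: K x => [|K IH] x; first by rewrite big_geq ?ler01.
apply: le_trans (kA x); rewrite big_nat_recl //= expr0 mul1mx lerD2l.
under eq_bigr do rewrite exprS -[_ * _]/(_ *m _) -mulmxA mxE.
rewrite exchange_big; apply: ler_sum => j _.
by rewrite -mulr_sumr ler_piMr.
Qed.

Lemma le_of_scaled_le (f B : R) m :
  (forall rho : R, 0 < rho < 1 -> rho ^+ m * f <= B) -> f <= B.
Proof.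
move=> rhof.
have cv : (fun rho : R => rho ^+ m * f) @ 1^'- --> f.
  rewrite -[X in _ --> X]mul1r; apply: cvgMr_tmp; rewrite -[X in _ --> X](expr1n R m).
  by apply: cvg_at_left_filter; exact: (@exprn_continuous R m 1).
apply: (cvgr_to_le cv); near=> rho; apply: rhof; apply/andP; split=> //.
Unshelve. all: by end_near. Qed.

(** Scaling [M] by [rho < 1] keeps all rates below [1] and costs a factor [rho ^+ m], which
    disappears as [rho] tends to [1]. *)
Lemma symmetrizable_exit_le M kappa (S : 'M[R]_n) (v : 'I_n -> R) m x :
  (forall i j, 0 <= M i j) -> (forall i, 0 <= kappa i 0) ->
  (forall i, kappa i 0 + \sum_j M i j <= 1) ->
  (forall i, 0 < v i) -> (forall i j, M i j = v j / v i * (S^T *m S) i j) ->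
  (2 * n <= m.+1)%N ->
  (M ^+ m *m kappa) x 0 <= Num.sqrt (n%:R / 2) / m.+1%:R.
Proof.
move=> M0 k0 kM v0 MS nm; apply: (@le_of_scaled_le _ _ m) => rho /andP[rho0 rho1].
pose A := rho *: M.
have A0 i j : 0 <= A i j by rewrite mxE mulr_ge0 // ltW.
have sumA i : \sum_j A i j = rho * \sum_j M i j.
  by rewrite mulr_sumr; apply: eq_bigr => j _; rewrite mxE.
have sM0 i : 0 <= \sum_j M i j by apply: sumr_ge0.
have sM1 i : \sum_j M i j <= 1 by apply: le_trans (kM i); rewrite lerDr.
have -> : rho ^+ m * (M ^+ m *m kappa) x 0 = exit A kappa [set: 'I_n] x m.+1.
  rewrite /= restr_setT; have -> : A ^+ m = rho ^+ m *: M ^+ m.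
    elim: m {nm} => [|m IH]; first by rewrite !expr0 scale1r.
    by rewrite !exprS IH -[LHS]/(_ *m _) -scalemxAr -scalemxAl scalerA mulrC.
  by rewrite -scalemxAl [RHS]mxE.
have Arho i : \sum_j A i j <= rho by rewrite sumA ler_piMr // ltW.
apply: geom_mixture_le; last 3 first.
- move=> K; apply: sum_exit_le1 => // i; apply: le_trans (kM i).
  by rewrite lerD2l sumA ler_piMl // ltW.
- exact: nm.
- by [].
rewrite -[n in geom_mixture n]card_ord -cardsT; apply: exit_mixture => // D z zD.
apply: (@restr_moments A (Num.sqrt rho *: S) v rho) => //; first by rewrite ltW.
move=> i j; rewrite [LHS]mxE MS.
have -> : (Num.sqrt rho *: S)^T *m (Num.sqrt rho *: S) = rho *: (S^T *m S).
  have -> : (Num.sqrt rho *: S)^T = Num.sqrt rho *: S^T by apply/matrixP => a b; rewrite !mxE.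
  by rewrite -scalemxAl -scalemxAr scalerA -expr2 sqr_sqrtr ?ltW.
by rewrite [in RHS]mxE; ring.
Qed.

End SymmetrizableExit.

(** * Reversible Markov chains *)

Section ReversibleChain.
Variables (R : realType) (S : finType) (p : S -> S -> R).

(** Index [t] stands for time [t + 1]: only visits at positive times count, even when [a = y]. *)
Fixpoint hitting_pmf (y : S) (t : nat) (a : S) : R :=
  if t is t'.+1 then \sum_(b | b != y) p a b * hitting_pmf y t' b else p a y.

Local Notation n := #|S|.

(** The killed kernel keeps [y] as an index, with null row and column, so that the matrices have
    size [n]. *)
Lemma hitting_pmf_mx y t i : enum_val i != y ->
  hitting_pmf y t (enum_val i) =
  ((\matrix_(i < n, j < n) (((enum_val i != y) && (enum_val j != y))%:R *
      p (enum_val i) (enum_val j))) ^+ t *m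
   \col_(i < n) ((enum_val i != y)%:R * p (enum_val i) y)) i 0.
Proof.
move=> iy; elim: t i iy => [|t IH] i iy; first by rewrite expr0 mul1mx mxE iy mul1r.
rewrite exprS -[_ * _]/(_ *m _) -mulmxA [RHS]mxE /=.
rewrite (reindex_onto enum_val enum_rank) /=; last by move=> a _; rewrite enum_rankK.
rewrite big_mkcond; apply: eq_bigr => j _; rewrite enum_valK eqxx andbT mxE iy /=.
by case: ifPn => [jy|_]; rewrite ?mul0r // mul1r IH.
Qed.

Lemma hitting_pmf_le (x y : S) t : stochastic p -> reversible p -> x != y ->
  (4 * n + 4 <= t.+1)%N ->
  hitting_pmf y t x <= Num.sqrt (2 * n%:R) / t.+1%:R.
Proof.
move=> [p0 p1] [pi [_ pi0 pirev]] xy nt.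
pose i := enum_rank x; have xE : x = enum_val i by rewrite enum_rankK.
rewrite xE hitting_pmf_mx -?xE //.
set Q : 'M[R]_n := \matrix_(i, j) _; set r : 'cV[R]_n := \col_i _.
pose v (i : 'I_n) := Num.sqrt (pi (enum_val i)).
have v0 k : 0 < v k by rewrite sqrtr_gt0.
(* By reversibility [T] is symmetric, so [T^T *m T] is its square, which is similar to [Q *m Q];
   this is where pairing the steps gives positivity. *)
pose T : 'M[R]_n := \matrix_(i, j) (v i * Q i j / v j).
have Q0 k j : 0 <= Q k j by rewrite mxE mulr_ge0.
have r0 k : 0 <= r k 0 by rewrite mxE mulr_ge0.
have Qr k : r k 0 + \sum_j Q k j <= 1.
  rewrite -(p1 (enum_val k)) (bigD1 y) //= lerD //.
    by rewrite mxE; case: (_ != _); rewrite ?mul1r ?mul0r.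
  rewrite [leRHS](reindex_onto enum_val enum_rank) /=; last by move=> a _; rewrite enum_rankK.
  rewrite [leRHS]big_mkcond; apply: ler_sum => j _; rewrite enum_valK eqxx andbT mxE.
  by do 2!case: (_ != _); rewrite ?mul1r ?mul0r //.
have Tsym : T^T = T.
  apply/matrixP => k j; rewrite !mxE andbC.
  have := pirev (enum_val k) (enum_val j).
  have vE l : pi (enum_val l) = v l ^+ 2 by rewrite sqr_sqrtr ?ltW.
  rewrite !vE => e; case: (_ && _); last by rewrite !mul0r !mulr0 !mul0r.
  rewrite !mul1r; apply/eqP; rewrite eqr_div ?(gt_eqF (v0 _)) //; apply/eqP.
  by transitivity (v j ^+ 2 * p (enum_val j) (enum_val k)); [ring | rewrite -e; ring].
have TT : T^T *m T = \matrix_(i, j) (v i * (Q *m Q) i j / v j).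
  rewrite Tsym; apply/matrixP => k j; rewrite !mxE mulr_sumr mulr_suml.
  apply: eq_bigr => l _; rewrite !mxE.
  by field; rewrite !gt_eqF.
(* From [4n + 4 <= t + 1 <= 2(m + 1)] follow both [2n <= m + 1] and [sqrt(n / 2) / (m + 1) <=
   sqrt(2n) / (t + 1)]. *)
have bound (kappa : 'cV[R]_n) m : (forall k, 0 <= kappa k 0) ->
    (forall k, kappa k 0 + \sum_j (Q *m Q) k j <= 1) -> (t.+1 <= 2 * m.+1)%N ->
    ((Q *m Q) ^+ m *m kappa) i 0 <= Num.sqrt (2 * n%:R) / t.+1%:R.
  move=> kappa0 kappa1 tm.
  have exit_le := @symmetrizable_exit_le R n (Q *m Q) kappa T v m i.
  apply: le_trans (exit_le _ kappa0 kappa1 v0 _ _) _.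
  - by move=> k j; rewrite mxE sumr_ge0 // => l _; rewrite mulr_ge0.
  - by move=> k j; rewrite TT [in RHS]mxE; field; rewrite !gt_eqF.
  - by lia.
  rewrite ler_pdivrMr ?ltr0n // mulrAC ler_pdivlMr ?ltr0n //.
  have -> : Num.sqrt (2 * n%:R) = 2 * Num.sqrt (n%:R / 2) :> R.
    rewrite (_ : 2 * n%:R = 2 ^+ 2 * (n%:R / 2)); last by field.
    by rewrite sqrtrM ?sqr_ge0 // sqrtr_sqr ger0_norm.
  rewrite -mulrA mulrCA ler_wpM2l ?sqrtr_ge0 // -natrM ler_nat.
  exact: tm.
have QQle k : \sum_j (Q *m Q) k j <= \sum_j Q k j.
  under eq_bigr do rewrite mxE.
  rewrite exchange_big; apply: ler_sum => l _; rewrite -mulr_sumr ler_piMr //.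
  by apply: le_trans (Qr l); rewrite lerDr.
have Q1 k : \sum_j Q k j <= 1 by apply: le_trans (Qr k); rewrite lerDr.
have QX m : (Q *m Q) ^+ m = Q ^+ (2 * m) by rewrite exprM expr2.
(* For odd [t] the unpaired step goes into the killing vector, [Q *m r]; for even [t] this vector is
   [r]. *)
case: (boolP (odd t)) => todd.
  have tE : t = (2 * t./2).+1 by lia.
  rewrite [in Q ^+ _]tE exprSr -[_ * _]/(_ *m _) -QX -mulmxA.
  apply: bound => [k|k|]; last by lia.
    by rewrite mxE sumr_ge0 // => l _; rewrite mulr_ge0.
  apply: le_trans (Q1 k); under eq_bigr do rewrite mxE.
  rewrite exchange_big mxE -big_split; apply: ler_sum => l _ /=.
  by rewrite -mulr_sumr -mulrDr ler_piMr.
have tE : t = (2 * t./2)%N by lia.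
rewrite [in Q ^+ _]tE -QX; apply: bound => [//|k|]; last by lia.
by apply: le_trans (Qr k); rewrite lerD2l.
Qed.

End ReversibleChain.

(** * From path events to the killed kernel *)

Fixpoint first_visit (T S : Type) (X : nat -> T -> S) (y : S) (s t : nat) : set T :=
  if t is t'.+1 then ~` (X s @^-1` [set y]) `&` first_visit X y s.+1 t'
  else X s @^-1` [set y].

Lemma first_visitP (T : Type) (S : eqType) (X : nat -> T -> S) y s t w :
  first_visit X y s t w <->
  X (s + t)%N w = y /\ forall k, (k < t)%N -> X (s + k)%N w <> y.
Proof.
elim: t s => [|t IH] s /=; first by rewrite addn0; split=> [|[]].
split=> [[Xs /IH[Xt Xk]]|[Xt Xk]].
  by rewrite addnS; split=> // -[|k] kt; rewrite ?addn0 // addnS; apply: Xk.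
split; first by have := Xk 0%N isT; rewrite addn0.
by apply/IH; rewrite addSnnS; split=> // k kt; rewrite addSnnS; apply: Xk.
Qed.

Lemma hitting_timeE (T : Type) (S : finType) (X : nat -> T -> S) y t :
  [set w | hitting_time X y w = Some t] = first_visit X y 0 t.
Proof.
apply/seteqP; split=> w /=; rewrite /hitting_time first_visitP add0n.
  case: pselect => // ex; case: ex_minnP => m /eqP Xm min [<-]; split=> // k km Xk.
  by have := min k; rewrite Xk eqxx leqNgt km => /(_ isT).
move=> [Xt Xk]; case: pselect => [ex|[]]; last by exists t; apply/eqP.
case: ex_minnP => m /eqP Xm min; congr Some; apply/eqP; rewrite eqn_leq.
rewrite min ?Xt ?eqxx //= leqNgt; apply/negP => mt; exact: Xk Xm.
Qed.

Lemma measure_big_setU_le d (T : ringOfSetsType d) (R : realFieldType)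
    (mu : {content set T -> \bar R}) (I : Type) (r : seq I) (P : pred I) (F : I -> set T) :
  (forall i, P i -> measurable (F i)) ->
  (mu (\big[setU/set0]_(i <- r | P i) F i) <= \sum_(i <- r | P i) mu (F i))%E.
Proof.
move=> mF; elim: r => [|i r IH]; first by rewrite !big_nil measure0.
rewrite !big_cons; case: ifP => // Pi.
apply: le_trans (measureU2 _ _ _) _ => //; [exact: mF | exact: bigsetU_measurable|].
by rewrite leeD2l.
Qed.

Section MarkovChain.
Variables (d : measure_display) (T : measurableType d) (R : realType) (S : finType).
Variables (p : S -> S -> R) (x : S) (P : probability T R) (X : nat -> T -> S).
Hypothesis chainX : markov_chain_from p x P X.

Let mX t a : measurable (X t @^-1` [set a]).
Proof. by case: chainX. Qed.

Let p_ge0 a b : 0 <= p a b.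
Proof. by have [[]] := chainX. Qed.

Let pmf_ge0 y t a : 0 <= hitting_pmf p y t a.
Proof. by elim: t a => [|t IH] a //=; apply: sumr_ge0 => b _; rewrite mulr_ge0. Qed.

Lemma historyS a t :
  history X a t.+1 = history X a t `&` X t.+1 @^-1` [set a t.+1].
Proof.
apply/seteqP; split=> w /=.
  by move=> h; split; [move=> s st; apply: h; apply: leqW | apply: h].
by move=> [h ht] s; rewrite leq_eqVlt => /predU1P[-> //|]; apply: h.
Qed.

Lemma measurable_history a t : measurable (history X a t).
Proof.
elim: t => [|t IH]; last by rewrite historyS; apply: measurableI.
rewrite (_ : history X a 0 = X 0%N @^-1` [set a 0%N]) //.
apply/seteqP; split=> w /=; first by apply.
by move=> h s; rewrite leqn0 => /eqP ->.
Qed.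

Lemma measurable_first_visit y s t : measurable (first_visit X y s t).
Proof. by elim: t s => [|t IH] s //=; apply: measurableI => //; apply: measurableC. Qed.

Lemma prob_historyS a t :
  P (history X a t.+1) = (P (history X a t) * (p (a t) (a t.+1))%:E)%E.
Proof.
have mh := measurable_history a t; have mh' := measurable_history a t.+1.
(* A null history has no transition rule, but then both sides vanish. *)
have [h0|h0] := eqVneq (P (history X a t)) 0%E.
  rewrite h0 mul0e; apply/eqP; rewrite eq_le measure_ge0 andbT -h0.
  by apply: le_measure; rewrite ?inE // historyS; apply: subIsetl.
have [_ _ _ /(_ t a (a t.+1) h0)] := chainX.
rewrite /cond_prob setIC -historyS => <-.
have fin B : measurable B -> P B \is a fin_num by move=> mB; apply: fin_num_measure.
rewrite -(fineK (fin _ mh')) -[X in (X * _)%E](fineK (fin _ mh)) -EFinM.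
by rewrite mulrCA divff ?mulr1 // fine_eq0 // fin.
Qed.

(** Induct on [t], extending the history by each value [b != y] at time [s + 1]. An upper bound is
    enough, so subadditivity replaces disjointness. *)
Lemma prob_history_first_visit y a s t :
  (P (history X a s `&` first_visit X y s.+1 t) <=
   P (history X a s) * (hitting_pmf p y t (a s))%:E)%E.
Proof.
pose upd (a : nat -> S) s b k := if (k <= s)%N then a k else b.
have updS c r b : P (history X (upd c r b) r.+1) = (P (history X c r) * (p (c r) b)%:E)%E.
  rewrite prob_historyS /upd leqnn ltnn; congr (P _ * _)%E.
  by apply/seteqP; split=> w h k ks; have := h k ks; rewrite ks.
have splitS c r b w : history X c r w -> X r.+1 w = b -> history X (upd c r b) r.+1 w.
  move=> h Xb k; rewrite leq_eqVlt => /predU1P[->|]; rewrite /upd ?ltnn //.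
  by rewrite ltnS => ks; rewrite ks; apply: h.
elim: t a s => [|t IH] a s /=.
  rewrite -updS; apply: le_measure; rewrite ?inE; last by move=> w [h Xy]; apply: splitS.
    by apply: measurableI => //; apply: measurable_history.
  exact: measurable_history.
pose F b := history X (upd a s b) s.+1 `&` first_visit X y s.+2 t.
have mF b : measurable (F b).
  by apply: measurableI; [apply: measurable_history | apply: measurable_first_visit].
apply: (@le_trans _ _ (P (\big[setU/set0]_(b <- index_enum S | b != y) F b))).
  apply: le_measure; rewrite ?inE.
  - apply: measurableI; first exact: measurable_history.
    exact: (measurable_first_visit y s.+1 t.+1).
  - by apply: bigsetU_measurable => b _; apply: mF.
  move=> w [h [Xy fv]]; rewrite (bigD1 (X s.+1 w)) /=; last exact/eqP.
  by left; split=> //; apply: splitS.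
apply: le_trans (measure_big_setU_le _ _ _) _; first by move=> b _; apply: mF.
rewrite -sumEFin ge0_sume_distrr; last first.
  by move=> b _; rewrite lee_fin mulr_ge0.
apply: lee_sum => b _; apply: le_trans (IH _ _) _.
by rewrite updS EFinM muleA /upd ltnn.
Qed.

Lemma prob_first_visit y t : x != y ->
  (P (first_visit X y 0 t.+1) <= (hitting_pmf p y t x)%:E)%E.
Proof.
move=> xy; have [_ _ PX0 _] := chainX.
have hx : history X (fun=> x) 0 = X 0%N @^-1` [set x].
  by apply/seteqP; split=> w /= h; [apply: h | move=> s; rewrite leqn0 => /eqP ->].
have := prob_history_first_visit y (fun=> x) 0 t; rewrite hx PX0 mul1e.
apply: le_trans.
have mfv := measurable_first_visit y 1 t; have mx := mX 0 x.
have PX0C : P (~` (X 0%N @^-1` [set x])) = 0%E by rewrite probability_setC // PX0 subee.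
(* [X 0 = x] holds only almost surely, so the null event where it fails is added to the cover. *)
rewrite -[leRHS]adde0 -PX0C.
apply: le_trans (measureU2 _ _ _); [|exact: measurableI|exact: measurableC].
apply: le_measure; rewrite ?inE.
- exact: (measurable_first_visit y 0 t.+1).
- by apply: measurableU; [apply: measurableI | apply: measurableC].
by move=> w [_ fv]; have [Xx|Xx] := pselect (X 0%N w = x); [left | right].
Qed.

Lemma prob_first_visit_start t : P (first_visit X x 0 t.+1) = 0%E.
Proof.
have [_ _ PX0 _] := chainX; have mx := mX 0 x.
have PX0C : P (~` (X 0%N @^-1` [set x])) = 0%E by rewrite probability_setC // PX0 subee.
apply/eqP; rewrite eq_le measure_ge0 andbT -PX0C.
apply: le_measure; rewrite ?inE; [|exact: measurableC | by move=> w []].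
exact: (measurable_first_visit x 0 t.+1).
Qed.

End MarkovChain.

Theorem theorem1p3 (R : realType) (n : nat) (S : finType) (cardS : #|S| = n)
    (p : S -> S -> R) (prev : reversible p) (x y : S)
    (d : measure_display) (Omega : measurableType d) (Px : probability Omega R)
    (X : nat -> Omega -> S) (chainX : markov_chain_from p x Px X)
    (t : nat) (ht : (4 * n + 4 <= t)%N) :
  (Px [set w | hitting_time X y w = Some t]
     <= (Num.sqrt (2 * n%:R) / t%:R)%:E)%E /\
  (Px (new_state_at X t) <= (n%:R * Num.sqrt (2 * n%:R) / t%:R)%:E)%E.
Proof.
have hit_le z : (Px [set w | hitting_time X z w = Some t]
    <= (Num.sqrt (2 * n%:R) / t%:R)%:E)%E.
  rewrite hitting_timeE; case: t ht => [|t] ht; first by rewrite leqn0 addn4 in ht.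
  have [<-|xz] := eqVneq x z.
    by rewrite (prob_first_visit_start chainX) lee_fin divr_ge0 ?sqrtr_ge0.
  apply: le_trans (prob_first_visit chainX t xz) _; rewrite lee_fin -cardS.
  by apply: hitting_pmf_le => //; [have [] := chainX | rewrite cardS].
split; first exact: hit_le.
have m_hit z : measurable [set w | hitting_time X z w = Some t].
  by rewrite hitting_timeE; apply: measurable_first_visit chainX _ _ _.
have -> : new_state_at X t =
    \big[setU/set0]_(z : S) [set w | hitting_time X z w = Some t].
  rewrite /new_state_at -bigcup_seq; congr (\bigcup_(z in _) _).
  by apply/seteqP; split=> // z _ /=; rewrite mem_index_enum.
apply: le_trans (measure_big_setU_le Px _ _) _; first by move=> z _; apply: m_hit.
apply: le_trans (lee_sum _ (fun z _ => hit_le z)) _.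
by rewrite sumEFin lee_fin sumr_const cardS -[leLHS]mulr_natl mulrA.
Qed.
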